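(* Let $(S,\cdot,\ast)$ be a regular $\star$-semigroup. Define binary operations $+$ and $\oplus$ on $S$ by $a+b=ab$ and $a\oplus b=ba$ for all $a,b\in S$. Then the map associated to $(S,+,\cdot,\ast)$ is a solution of the Yang-Baxter equation if and only if $(S,\cdot,\ast)$ is completely regular, orthodox and locally inverse. Likewise, the map associated to $(S,\oplus,\cdot,\ast)$ is a solution of the Yang-Baxter equation if and only if $(S,\cdot,\ast)$ is completely regular, orthodox and locally inverse.
   Context: A regular $\star$-semigroup is a triple $(S,\cdot,\ast)$ where $(S,\cdot)$ is a semigroup on a non-empty set and $\ast:S\to S$, $x\mapsto x^\ast$, satisfies $xx^\ast x=x$, $(x^\ast)^\ast=x$, $(xy)^\ast=y^\ast x^\ast$ for all $x,y\in S$. It is called completely regular if $a\,\mathcal H\,a^2$ for all $a\in S$ ($\mathcal H=\mathcal L\cap\mathcal R$ being Green's relation), orthodox if the product of any two idempotents is idempotent, and locally inverse if $eSe$ is an inverse semigroup for every idempotent $e$. For a set $S$ with binary operations $+,\cdot$ and a unary operation $\ast$, the map associated to $(S,+,\cdot,\ast)$ is $r_S:S\times S\to S\times S$, $r_S(a,b)=(a(a^{\ast}+b),\,(a^{\ast}+b)^{\ast}b)$; similarly with $\oplus$ in place of $+$. A map $r:S\times S\to S\times S$ is a (set-theoretic) solution of the Yang-Baxter equation if $(r\times \mathrm{id}_S)(\mathrm{id}_S\times r)(r\times \mathrm{id}_S)=(\mathrm{id}_S\times r)(r\times \mathrm{id}_S)(\mathrm{id}_S\times r)$ as maps $S^3\to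 S^3$. *)

(* Defs.v *)
From mathcomp Require Import all_boot.

Set Implicit Arguments.
Unset Strict Implicit.
Unset Printing Implicit Defensive.

(* The carrier is an arbitrary type: MathComp's [semigroupType] would require
   a [choiceType], hence decidable equality. *)
Record regular_star_semigroup (S : Type) (mul : S -> S -> S) (star : S -> S) :
    Prop := RegularStarSemigroup {
  rss_inhabited : inhabited S;
  rss_mulA : associative mul;
  rss_regular : forall x, mul (mul x (star x)) x = x;
  rss_starK : involutive star;
  rss_starM : forall x y, star (mul x y) = mul (star y) (star x)
}.

Section Semigroups.
Variables (S : Type) (mul : S -> S -> S).
Local Notation "x * y" := (mul x y).

Definition idempotent_elt (e : S) : Prop := e * e = e.

(* The principal one-sided ideals S^1 a and a S^1. *)
Definition left_ideal (a z : S) : Prop := z = a \/ exists s, z = s * a.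
Definition right_ideal (a z : S) : Prop := z = a \/ exists s, z = a * s.

Definition green_L (a b : S) : Prop :=
  forall z, left_ideal a z <-> left_ideal b z.
Definition green_R (a b : S) : Prop :=
  forall z, right_ideal a z <-> right_ideal b z.
Definition green_H (a b : S) : Prop := green_L a b /\ green_R a b.

Definition completely_regular : Prop := forall a, green_H a (a * a).

Definition orthodox : Prop :=
  forall e f, idempotent_elt e -> idempotent_elt f -> idempotent_elt (e * f).

Definition subsemigroup (A : S -> Prop) : Prop :=
  (exists x, A x) /\ (forall x y, A x -> A y -> A (x * y)).

(* Inverses are taken inside [A], so that [A] is an inverse semigroup in its
   own right. *)
Definition inverse_subsemigroup (A : S -> Prop) : Prop :=
  subsemigroup A /\
  forall x, A x -> exists! y, [/\ A y, x * y * x = x & y * x * y = y].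

Definition local_submonoid (e x : S) : Prop := exists s, x = e * s * e.

Definition locally_inverse : Prop :=
  forall e, idempotent_elt e -> inverse_subsemigroup (local_submonoid e).

End Semigroups.

Definition associated_map (S : Type) (add mul : S -> S -> S) (star : S -> S)
    (p : S * S) : S * S :=
  let: (a, b) := p in
  (mul a (add (star a) b), mul (star (add (star a) b)) b).

Section YangBaxter.
Variables (S : Type) (r : S * S -> S * S).

(* r x id and id x r on S^3, with S^3 encoded as (S * S) * S. *)
Definition map_left (t : S * S * S) : S * S * S :=
  let: (x, y, z) := t in let: (u, v) := r (x, y) in (u, v, z).
Definition map_right (t : S * S * S) : S * S * S :=
  let: (x, y, z) := t in let: (u, v) := r (y, z) in (x, u, v).

Definition YBE_solution : Prop :=
  map_left \o map_right \o map_left =1 map_right \o map_left \o map_right.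

End YangBaxter.

(* Main.v *)
(** For [+], with [a'] for the star of [a], the associated map is
    [r (a, b) = (aa'b, b'ab)], so the braid relation amounts to three word
    identities in [x, y, z].  The first one at [x = y] gives
    [aa' . a'a . aa' = aa'], which is complete regularity, and at projections
    it says that a product of three projections is idempotent, which is
    orthodoxy.  The second one, at [x = y] idempotent below a projection [z],
    gives [x = x'x]: all idempotents of a local submonoid [zSz] are projections,
    hence they commute.

    Conversely, the three properties make projections central between any two
    factors of a product, where moreover [aa'] and [a'a] are interchangeable;
    the word identities follow.  The star exchanges [+] and [o+], which
    settles the second map. *)
Require Import Defs.
From mathcomp Require Import all_boot.

Set Implicit Arguments.
Unset Strict Implicit.
Unset Printing Implicit Defensive.

Section RegularStarSemigroup.
Variables (S : Type) (mul : S -> S -> S) (star : S -> S).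
Hypothesis hS : regular_star_semigroup mul star.

Local Notation "x * y" := (mul x y).
Local Notation "x ^*" := (star x).
Local Notation idem := (idempotent_elt mul).

Let mulA : associative mul. Proof. by case: hS. Qed.
Let reg x : x * x^* * x = x. Proof. by case: hS. Qed.
Let starK : involutive star. Proof. by case: hS. Qed.
Let starM x y : (x * y)^* = y^* * x^*. Proof. by case: hS. Qed.
Let regs x : x^* * x * x^* = x^*.
Proof. by have := reg x^*; rewrite starK. Qed.

Local Ltac assoc := by rewrite ?starM ?starK !mulA.

Local Ltac prefix t w :=
  lazymatch w with
  | ?a * ?b => let u := prefix t a in constr:(u * b)
  | _ => constr:(t * w)
  end.

(* Rewrites a factor, not necessarily an initial one, of a product bracketed to
   the left. *)
Local Ltac wrew E :=
  let H := fresh in let K := fresh in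
  pose proof E as H; rewrite /idempotent_elt ?mulA in H;
  lazymatch type of H with
  | ?l = ?r =>
    assert (K : forall t,
        ltac:(let u := prefix t l in let v := prefix t r in exact (u = v)))
      by (let t := fresh in intro t; have := congr1 (mul t) H;
          rewrite !mulA; exact);
    first [rewrite K | rewrite H]; clear H K
  end.

(** * Projections, and idempotents as products of two of them *)

Definition projection (p : S) : Prop := p^* = p /\ idem p.

Lemma proj_mulstar a : projection (a * a^*).
Proof.
by split; [rewrite starM starK | rewrite /idempotent_elt mulA reg].
Qed.

Lemma proj_starmul a : projection (a^* * a).
Proof. by have := proj_mulstar a^*; rewrite starK. Qed.

Lemma proj_conj p q : projection p -> projection q -> projection (p * q * p).
Proof.
move=> [sp pp] [sq qq]; have := proj_mulstar (p * q).
by rewrite starM sp sq !mulA -(mulA p q q) qq.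
Qed.

Lemma proj_mul_idem p q : projection p -> projection q -> idem (p * q).
Proof.
move=> [sp pp] [sq qq]; rewrite /idempotent_elt -{3}(reg (p * q)) starM sp sq.
by rewrite !mulA -(mulA p q q) qq -(mulA _ p p) pp.
Qed.

Lemma idem_star e : idem e -> idem e^*.
Proof. by rewrite /idempotent_elt => ee; rewrite -starM ee. Qed.

Lemma idem_factor e : idem e -> (e * e^*) * (e^* * e) = e.
Proof.
move=> ee; have := idem_star ee; rewrite /idempotent_elt => es.
by rewrite mulA -(mulA e) es reg.
Qed.

(** * Equational forms of the three properties *)

Lemma completely_regularP :
  completely_regular mul <->
  forall a, (a * a^*) * (a^* * a) * (a * a^*) = a * a^*.
Proof.
split=> [cr a | cr a].
  have [t Et] : exists t, a = t * (a * a).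
    have [L _] := cr a; case: (L a) => + _; case; first by left.
      by move=> Ea; exists (a * a^*); rewrite mulA reg.
    by [].
  (* Writing the leading [a] as [taa] exposes [aa(aa)'aa], which regularity collapses. *)
  have aE : a * (a * a)^* * (a * a) = a.
    transitivity (t * (a * a * (a * a)^* * (a * a))); last by rewrite reg -Et.
    by rewrite !mulA -(mulA t a a) -Et.
  by transitivity (a * (a * a)^* * (a * a) * a^*); [assoc | rewrite aE].
(* The identity for [a'] puts [a] in [aaS]; the one for [a] puts it in [Saa]. *)
have aR : a = (a * a) * (a^* * a^* * a).
  rewrite -{1}(reg a) -mulA; have := cr a^*; rewrite starK => <-.
  transitivity ((a * a^* * a) * (a * a^*) * a^* * a); first by assoc.
  by rewrite reg; assoc.
have aL : a = (a * a^* * a^*) * (a * a).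
  rewrite -{1}(reg a) -{1}(cr a).
  transitivity ((a * a^*) * (a^* * a) * (a * a^* * a)); first by assoc.
  by rewrite reg; assoc.
split=> z; split=> - [-> | [s ->]].
- by right; exists (a * a^* * a^*).
- by right; exists (s * (a * a^* * a^*)); rewrite {1}aL; assoc.
- by right; exists a.
- by right; exists (s * a); assoc.
- by right; exists (a^* * a^* * a).
- by right; exists (a^* * a^* * a * s); rewrite {1}aR; assoc.
- by right; exists a.
- by right; exists (a * s); assoc.
Qed.

(** The product [ef] is one of four projections. The first three form an idempotent, again a product
    of two projections, so three remain. *)
Lemma orthodox_of_proj :
  (forall p q r, projection p -> projection q -> projection r ->
     idem (p * q * r)) -> orthodox mul.
Proof.
move=> H e f ee ff; rewrite -(idem_factor ee) -(idem_factor ff).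
have [pu pv] := (proj_mulstar e, proj_starmul e).
have [ps pt] := (proj_mulstar f, proj_starmul f).
rewrite [X in idem X]mulA -(idem_factor (H _ _ _ pu pv ps)).
exact: H (proj_mulstar _) (proj_starmul _) pt.
Qed.

(** An idempotent [a] of [rSr] has both [a] and [a'] as inverses there, so uniqueness gives
    [a' = a]. Conversely, self-adjointness makes the idempotents of each [eSe] commute, hence
    inverses are unique. *)
Lemma locally_inverseP : orthodox mul ->
  locally_inverse mul <->
  (forall r a, projection r -> idem a -> r * a = a -> a * r = a -> a^* = a).
Proof.
move=> ort; split=> [li r a [sr rr] aa ra ar | li e ee].
  have la : local_submonoid mul r a by exists a; rewrite ra ar.
  have [_ /(_ a la) [y [_ uy]]] := li r rr.
  rewrite -[RHS](_ : y = a); last by apply: uy; split=> //; rewrite aa aa.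
  apply/esym/uy; split; [exists a^*| exact: reg | exact: regs].
  by rewrite -[in LHS]ra -[in LHS]ar !starM sr.
have lP x : local_submonoid mul e x -> e * x = x /\ x * e = x.
  by case=> s ->; split; rewrite ?mulA ?ee // -mulA ee.
have comm f g : local_submonoid mul e f -> local_submonoid mul e g ->
    idem f -> idem g -> f * g = g * f.
  move=> /lP [ef fe] /lP [eg ge] ff gg.
  (* Since [e] may fail to be a projection, right multiplication by [a] moves idempotents of [eSe]
     below the projection [a], where they are self-adjoint; [ae = e] leads back. *)
  pose a := e * e^*; have pa : projection a by exact: proj_mulstar.
  have ae : a * e = e by exact: reg.
  have af x : e * x = x -> a * x = x by move=> <-; rewrite mulA ae.
  have sadj x : e * x = x -> idem x -> (x * a)^* = x * a.
    move=> ex xx; apply: (li a) => //.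
    - by rewrite /idempotent_elt mulA -(mulA x) af // xx.
    - by rewrite mulA af.
    - by rewrite -mulA (proj2 pa).
  have E x y : e * y = y -> x * a * (y * a) = x * y * a.
    by move=> ey; rewrite mulA -(mulA x) af.
  have fga : f * g * a = g * f * a.
    rewrite -E // -(sadj f) // -(sadj g) // -starM E // sadj //.
      by rewrite mulA eg.
    exact: ort.
  by rewrite -ge mulA ge -ae mulA fga -mulA ae -mulA fe.
split.
  split; first by exists e; exists e; rewrite !ee.
  by move=> x y [s ->] [t ->]; exists (s * e * e * t); assoc.
move=> x lx; have [ex xe] := lP x lx.
have xy y : x * y * x = x -> idem (x * y) by rewrite /idempotent_elt mulA => ->.
have yx y : x * y * x = x -> idem (y * x).
  by rewrite /idempotent_elt => E; rewrite mulA -(mulA y) -(mulA y) E.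
have lM y z : local_submonoid mul e y -> local_submonoid mul e z ->
    local_submonoid mul e (y * z).
  by move=> /lP [ey ye] /lP [ez ze]; exists (y * z); rewrite mulA ey -mulA ze.
(* Two inverses of [x] agree through the common value [y2 * x * y1]. *)
have comm2 y1 y2 : local_submonoid mul e y1 -> local_submonoid mul e y2 ->
    x * y1 * x = x -> x * y2 * x = x -> y1 * x * y1 = y1 -> y1 = y2 * x * y1.
  move=> l1 l2 E1 E2 F1.
  rewrite -{1}F1 -{1}E2.
  transitivity ((y1 * x) * (y2 * x) * y1); first by assoc.
  rewrite (comm (y1 * x) (y2 * x)) //; try exact: lM; try exact: yx.
  by rewrite -[RHS](congr1 (fun u => y2 * x * u) F1); assoc.
have comm3 y1 y2 : local_submonoid mul e y1 -> local_submonoid mul e y2 ->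
    x * y1 * x = x -> x * y2 * x = x -> y2 * x * y2 = y2 -> y2 = y2 * x * y1.
  move=> l1 l2 E1 E2 F2.
  rewrite -{1}F2 -{1}E1.
  transitivity (y2 * ((x * y1) * (x * y2))); first by assoc.
  rewrite (comm (x * y1) (x * y2)) //; try exact: lM; try exact: xy.
  by rewrite !mulA F2.
have l1 : local_submonoid mul e (e * x^* * e) by exists x^*.
have E1 : x * (e * x^* * e) * x = x by rewrite !mulA xe -(mulA _ e x) ex reg.
have F1 : e * x^* * e * x * (e * x^* * e) = e * x^* * e.
  transitivity (e * (x^* * ((e * x) * e) * x^*) * e); first by assoc.
  by rewrite ex xe regs.
exists (e * x^* * e); split=> // y [ly E F]; apply/esym.
by rewrite (comm2 y (e * x^* * e)) //; apply/esym/comm3.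
Qed.

(** * The braid relation, coordinate by coordinate, for both additions *)

Definition braid_equations : Prop := forall x y z,
  [/\ x * x^* * y * y^* * x * x^* * y^* * x * y * y^* * x^* * y * z
        = x * x^* * y * y^* * z,
      z^* * y^* * x * y * y^* * x^* * y * x * x^* * y
          * y^* * x * y * y^* * x^* * y * z
        = z^* * y * y^* * x * y * y^* * z * z^* * y * y^* * x^* * y * y^* * z
          * z^* * y * z
    & z^* * y^* * x * y * z
        = z^* * y^* * z * z^* * y * y^* * x * y * y^* * z * z^* * y * z].

Lemma YBE_addP :
  YBE_solution (associated_map (fun a b => mul a b) mul star) <->
  braid_equations.
Proof.
split=> [H x y z | H [[x y] z]].
  have := H (x, y, z); rewrite /= => -[].
  by rewrite !starM !starK !mulA.
rewrite /=; have [E1 E2 E3] := H x y z.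
by rewrite !starM !starK !mulA E1 E2 E3.
Qed.

(* The involution [(a, b) |-> (star b, star a)] intertwines the two associated
   maps; on triples it exchanges [r x id] and [id x r]. *)
Lemma YBE_oadd :
  YBE_solution (associated_map (fun a b => mul b a) mul star) <->
  YBE_solution (associated_map (fun a b => mul a b) mul star).
Proof.
set rm := associated_map (fun a b => mul b a) mul star.
set rp := associated_map (fun a b => mul a b) mul star.
pose flip (t : S * S * S) := let: (x, y, z) := t in (z^*, y^*, x^*).
have flipK : involutive flip by case=> [[x y] z]; rewrite /= !starK.
have flipL t : map_left rm (flip t) = flip (map_right rp t).
  by case: t => [[x y] z] /=; rewrite !starM !starK !mulA.
have flipR t : map_right rm (flip t) = flip (map_left rp t).
  by case: t => [[x y] z] /=; rewrite !starM !starK !mulA.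
split=> H t.
  have := H (flip t); rewrite /= !(flipL, flipR).
  by move/(can_inj flipK).
by rewrite -(flipK t) /= !(flipL, flipR); congr flip; apply/esym/H.
Qed.

(** * Necessity of the three properties *)

Section Necessity.
Hypothesis braid : braid_equations.

Lemma braid_rect a : (a * a^*) * (a^* * a) * (a * a^*) = a * a^*.
Proof.
set e := a * a^*; set f := a^* * a.
have [_ ee] := proj_mulstar a; have [_ ff] := proj_starmul a.
have E z : e * f * e * f * z = e * z.
  have [+ _ _] := braid a a z => H.
  transitivity (e * e * e * f * e * f * z); first by rewrite ee ee.
  transitivity (e * e * z); last by rewrite ee.
  by move: H; rewrite /e /f !mulA.
(* Taking [z := f] gives [efef = ef]; then [z := e] yields [efe = e]. *)
have Ef : e * f * e * f = e * f by have := E f; rewrite -(mulA _ f f) ff.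
by have := E e; rewrite Ef ee.
Qed.

Lemma braid_orthodox : orthodox mul.
Proof.
apply: orthodox_of_proj => r p q pr pp pq.
have [[[sr rr] [sp ip]] [sq iq]] := (pr, pp, pq).
suff vE : (r * p * q * (r * p * q)^*) * ((r * p * q)^* * (r * p * q))
    = r * p * q.
  rewrite -[X in idem X]vE; apply: proj_mul_idem; first exact: proj_mulstar.
  exact: proj_starmul.
have qh := proj_mul_idem pq (proj_conj pp pr).
have pqi := proj_mul_idem pp pq.
(* With [v = rpq], this instance reduces to [vv'v'v = v], a product of the two projections [vv'] and
   [v'v]. *)
have [+ _ _] := braid r (p * q) q.
rewrite !starM sr sp sq !mulA rr => H.
transitivity (r * p * q * q * p * q); last by wrew iq; wrew pqi.
rewrite -H; do 6?wrew iq; do 4? wrew ip; do 4? wrew rr.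
by wrew qh.
Qed.

Lemma braid_locally_inverse : locally_inverse mul.
Proof.
apply/(locally_inverseP braid_orthodox) => r a [sr rr] aa ra ar.
have as_ := idem_star aa.
have sra : r * a^* = a^* by rewrite -{1}sr -starM ar.
have sar : a^* * r = a^* by rewrite -{1}sr -starM ra.
have C2 := braid_rect a^*; rewrite starK in C2.
have [_ + _] := braid a a r.
rewrite sr => H.
(* In the second identity, complete regularity collapses the left side to [a'a]; the right side
   collapses to [a]. *)
have E : a^* * a = a.
  transitivity (r * a^* * a * a * a^* * a^* * a * a * a^* * a
                * a^* * a * a * a^* * a^* * a * r).
    wrew C2; wrew C2; wrew (reg a); wrew (reg a); wrew aa.
    by rewrite sra -mulA ar.
  rewrite H; wrew rr; wrew rr; wrew sar; wrew sar; wrew ar; wrew ra.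
  by do 3?wrew (reg a); wrew aa; wrew as_; rewrite reg.
by rewrite -E starM starK E.
Qed.

End Necessity.

(** * Sufficiency: products enclosed between projections *)

Section Sufficiency.
Hypothesis rect : forall a, (a * a^*) * (a^* * a) * (a * a^*) = a * a^*.
Hypothesis ort : orthodox mul.
Hypothesis local_selfadjoint :
  forall r a, projection r -> idem a -> r * a = a -> a * r = a -> a^* = a.

(** By orthodoxy [rxr] is an idempotent below [r], hence equal to its star. *)
Lemma conj_star r x : projection r -> idem x -> r * x * r = r * x^* * r.
Proof.
move=> pr xx; have [sr rr] := pr.
rewrite -[LHS](@local_selfadjoint r) //.
- by rewrite !starM sr mulA.
- by apply: ort => //; apply: ort.
- by rewrite !mulA rr.
- by rewrite -mulA rr.
Qed.

Section Projections.
Variables r p q : S.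
Hypotheses (pr : projection r) (pp : projection p) (pq : projection q).

Lemma conj_projC : r * p * q * r = r * q * p * r.
Proof.
have := conj_star pr (proj_mul_idem pp pq).
by rewrite starM (proj1 pp) (proj1 pq) !mulA.
Qed.

(** Both sides, [k] and [A], are self-adjoint with [Ak = k] and [kA = A]; applying the star gives
    [k = A]. *)
Lemma conj_proj_absorb : r * p * q * p * r = r * p * q * r.
Proof.
have [[[sr rr] [sp ip]] [sq iq]] := (pr, pp, pq).
set A := RHS; set k := LHS.
have sA : A^* = A by rewrite /A conj_projC !starM sr sp sq !mulA -conj_projC.
have sk : k^* = k by rewrite /k !starM sr sp sq !mulA.
have vv : r * p * q * (r * p * q) = r * p * q.
  by apply: ort => //; apply: ort.
have Ak : A * k = k.
  transitivity ((r * p * q) * ((r * r) * p * q) * p * r); first by assoc.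
  by rewrite rr vv.
have kA : k * A = A.
  have := reg (r * p * q); rewrite !starM sr sp sq !mulA; wrew iq; wrew rr => E.
  by rewrite E.
by rewrite -Ak -sA -sk -starM kA sA.
Qed.

End Projections.

(** Both sides equal [rpqrprqr], the right one after squaring it as an idempotent. *)
Lemma conj_proj_split r p q :
  projection r -> projection p -> projection q ->
  r * p * q * r = r * p * r * q * r.
Proof.
move=> pr pp pq; have [[[sr rr] [sp ip]] [sq iq]] := (pr, pp, pq).
have MM : idem (r * p * r * q * r) by do !apply: ort.
transitivity (r * p * q * r * p * r * q * r).
  wrew (conj_projC pr pp pq); wrew (proj_mul_idem pp pr).
  by wrew (conj_projC pr pq pp); wrew (proj_mul_idem pq pr).
rewrite -{1}MM !mulA; wrew rr.
by wrew (conj_proj_absorb pp pr pq); wrew (conj_projC pp pr pq).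
Qed.

(** With [u = ff'] and [v = f'f] one has [f = uv], [u = uvu] and [v = vuv], so absorption
    applies. *)
Lemma conj_idem_mulstar r f : projection r -> idem f ->
  r * f * r = r * (f * f^*) * r /\ r * f * r = r * (f^* * f) * r.
Proof.
move=> pr ff; have fs := idem_star ff.
have [pu pv] := (proj_mulstar f, proj_starmul f).
have uv := idem_factor ff.
have uvu : f * f^* = f * f^* * (f^* * f) * (f * f^*).
  by rewrite !mulA; wrew fs; wrew ff; rewrite reg.
have vuv : f^* * f = f^* * f * (f * f^*) * (f^* * f).
  by rewrite !mulA; wrew ff; wrew fs; rewrite regs.
split.
  by rewrite uvu -{1}uv !mulA; have := conj_proj_absorb pr pu pv; rewrite !mulA.
rewrite vuv -{1}uv !mulA.
have := conj_proj_absorb pr pv pu; have := conj_projC pr pu pv.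
by rewrite !mulA => -> ->.
Qed.

(** Only [gg'] and [f'f] survive in [rfgr], in swapped order. Compressed by [r], the two projections
    of an idempotent coincide, and [conj_proj_split] lets one replace the other. *)
Lemma conj_idemC r f g : projection r -> idem f -> idem g ->
  r * f * g * r = r * g * f * r.
Proof.
have split_ r' f' g' : projection r' -> idem f' -> idem g' ->
    r' * f' * g' * r' = r' * (g' * g'^*) * (f'^* * f') * r'.
  move=> pr ff gg.
  have pw := proj_mulstar g'.
  have -> : r' * f' * g' * r' = r' * (f' * g') * r' by assoc.
  rewrite (conj_idem_mulstar pr (ort ff gg)).1.
  have -> : f' * g' * (f' * g')^* = f' * (g' * g'^*) * (f' * (g' * g'^*))^*.
    by rewrite !starM !starK !mulA; wrew (reg g').
  have ic : idem (f' * (g' * g'^*)) by apply: ort => //; exact: (proj2 pw).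
  rewrite -(conj_idem_mulstar pr ic).1 (conj_idem_mulstar pr ic).2.
  have := conj_proj_absorb pr pw (proj_starmul f').
  by rewrite !starM !starK !mulA.
move=> pr ff gg; rewrite (split_ r f g) // (split_ r g f) //.
have [pf pf'] := (proj_mulstar f, proj_starmul f).
have [pg pg'] := (proj_mulstar g, proj_starmul g).
have EF : r * (f^* * f) * r = r * (f * f^*) * r.
  by have [<- <-] := conj_idem_mulstar pr ff.
have EG : r * (g^* * g) * r = r * (g * g^*) * r.
  by have [<- <-] := conj_idem_mulstar pr gg.
rewrite (conj_projC pr pg pf') (conj_proj_split pr pf' pg) EF.
rewrite -(conj_proj_split pr pf pg) (conj_projC pr pf pg).
rewrite (conj_proj_split pr pg pf) -EG -(conj_proj_split pr pg' pf).
exact: conj_projC.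
Qed.

(* Both sides are reduced to [e * g * e * f * h * f * g * h]. *)
Lemma proj_swap e f g h :
  projection e -> projection f -> projection g -> projection h ->
  e * f * g * h = e * g * f * h.
Proof.
have half f' g' : projection e -> projection f' -> projection g' ->
    projection h -> e * f' * g' * h = e * f' * e * g' * h * g' * f' * h.
  move=> pe pf pg ph; have [[_ ee] [_ ff]] := (pe, pf).
  have [[_ gg] [_ hh]] := (pg, ph).
  (* Doubling this idempotent creates pairs of equal projections, between which idempotents
     commute. *)
  have ss : idem (e * f' * g' * h) by do !apply: ort.
  rewrite -{1}ss !mulA.
  by wrew (conj_idemC pf (ort gg hh) ee); wrew (conj_idemC ph ff gg).
move=> pe pf pg ph; rewrite (half f g) // (half g f) //.
have [[_ ee] [_ ff]] := (pe, pf); have [[_ gg] [_ hh]] := (pg, ph).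
have ghg := ort (ort gg hh) gg.
wrew (conj_idemC pf ee ghg); wrew (conj_idemC pe ff ghg).
wrew (conj_idemC ph (ort gg ff) (ort ee ff)).
by wrew (conj_idemC pg hh (ort ee ff)); wrew (conj_idemC ph gg ff).
Qed.

(** * Moving projections between arbitrary factors *)

Lemma mid_proj_swap x f g y : projection f -> projection g ->
  x * f * g * y = x * g * f * y.
Proof.
(* The outer factors supply the end projections: [x = xx'x] and [y = yy'y]. *)
move=> pf pg; have := proj_swap (proj_starmul x) pf pg (proj_mulstar y).
move/(congr1 (fun u => x * u * y)); rewrite !mulA.
by rewrite !reg; do 2!wrew (reg y).
Qed.

(** Between factors [aa'] and [a'a] commute, and [rect] for [a] and for [a'] identifies each with
    their product. *)
Lemma mid_mulstarC x a y : x * (a * a^*) * y = x * (a^* * a) * y.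
Proof.
have half b : x * (b * b^*) * y = x * (b^* * b) * (b * b^*) * y.
  have [pu pv] := (proj_mulstar b, proj_starmul b).
  transitivity (x * (b * b^*) * (b^* * b) * (b * b^* * y)).
    by rewrite -{1}(rect b); assoc.
  by rewrite (mid_proj_swap _ _ pu pv) !mulA; wrew (reg b).
rewrite half (mid_proj_swap _ _ (proj_starmul a) (proj_mulstar a)).
by have := half a^*; rewrite starK.
Qed.

(* With [p] the projection, [p] and [a * p * star a] have the same effect
   between [x] and [a * y]: the latter is [c * star c] for [c := a * p]. *)
Lemma mid_projC x p a y : projection p -> x * p * a * y = x * a * p * y.
Proof.
move=> pp; have [[sp ip] pf] := (pp, proj_starmul a).
have E : x * ((a * p) * (a * p)^*) * (a * y) = x * p * a * y.
  rewrite mid_mulstarC starM sp.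
  transitivity (x * p * (a^* * a) * p * (a * y)); first by assoc.
  rewrite (mid_proj_swap _ _ pp pf) -(mulA _ p p) ip -(mid_proj_swap _ _ pp pf).
  by rewrite -mid_mulstarC !mulA; wrew (reg a).
rewrite -E starM sp.
transitivity (x * a * p * (a^* * a) * y); first by rewrite !mulA; wrew ip.
rewrite (mid_proj_swap _ _ pp pf).
by rewrite !mulA; wrew (reg a).
Qed.

Lemma braid_of_normal : braid_equations.
Proof.
move=> x y z.
have [px py] := (proj_mulstar x, proj_mulstar y).
have pz := proj_mulstar z.
(* In this recurring block, [mid_projC] moves the inner [yy'] to the front and [xx'] to the back;
   the [y'y] left between them is traded for [yy']. *)
have conj u w : u * y^* * x * y * y^* * x^* * y * w
    = u * (y * y^*) * (x * x^*) * w.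
  wrew (esym (mid_projC y^* x x^* py)); wrew (esym (mid_projC u y^* x py)).
  wrew (mid_projC y^* y w px).
  wrew (esym (mid_mulstarC (y * y^*) y x)).
  by rewrite !mulA; wrew (reg y).
split.
- transitivity (x * x^* * (y * y^*) * (x * x^*)
                * y^* * x * y * y^* * x^* * y * z); first by assoc.
  rewrite conj !mulA; wrew (proj_mul_idem py px).
  wrew (mid_proj_swap (x * x^*) z py px).
  by wrew (reg x).
(* Both sides of the second identity reduce to this word. *)
- transitivity (z^* * (y * y^*) * (x * x^*) * y * z).
    wrew (conj z^* x); wrew (conj y z); wrew (reg x).
    wrew (esym (mid_projC x^* y x py)); wrew (reg y).
    by wrew (esym (mid_projC x^* y z px)); wrew (regs x); rewrite !mulA.
  wrew (mid_projC y^* y z pz); wrew (reg z).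
  wrew (esym (mid_projC z^* (y * y^* * x * y * y^*) y pz)); wrew (regs z).
  do 2!wrew (reg y).
  by wrew (esym (mid_projC y^* x x^* py)); wrew (regs y); rewrite !mulA.
- wrew (mid_projC y^* y z pz); wrew (esym (mid_projC z^* y^* y pz)).
  by wrew (reg z); wrew (regs z); wrew (regs y); wrew (reg y).
Qed.

End Sufficiency.

Lemma braid_equationsP : braid_equations <->
  [/\ completely_regular mul, orthodox mul & locally_inverse mul].
Proof.
split=> [br | [/completely_regularP cr ort li]].
  split; [exact/completely_regularP/braid_rect | exact: braid_orthodox |].
  exact: braid_locally_inverse.
by apply: braid_of_normal => //; apply/(locally_inverseP ort).
Qed.

End RegularStarSemigroup.

Theorem proposition4p1 (S : Type) (mul : S -> S -> S) (star : S -> S)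
    (hS : regular_star_semigroup mul star) :
  let add := fun a b : S => mul a b in
  let oadd := fun a b : S => mul b a in
  (YBE_solution (associated_map add mul star) <->
     [/\ completely_regular mul, orthodox mul & locally_inverse mul]) /\
  (YBE_solution (associated_map oadd mul star) <->
     [/\ completely_regular mul, orthodox mul & locally_inverse mul]).
Proof.
move=> add oadd; have E := iff_trans (YBE_addP hS) (braid_equationsP hS).
by split; [exact: E | exact: iff_trans (YBE_oadd hS) E].
Qed.
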